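(* For a quasigroup $\mathbb{Q}=(Q;\cdot,/,\backslash)$ let $\Gamma\mathbb{Q}$ have base set $Q^2\times\{\mathbb{Q}\}$ and multiplication $$(x_1,x_2,\mathbb{Q})\,\nabla\,(y_1,y_2,\mathbb{Q})=\bigl(x_2/\!/(x_1\cdot y_2),\;(x_1\cdot y_2)\backslash\!\backslash y_1,\;\mathbb{Q}\bigr),$$ and for a homotopy $(f_1,f_2,f_3):\mathbb{Q}\to\mathbb{R}$ let $\Gamma(f_1,f_2,f_3)$ be the map $(x_1,x_2,\mathbb{Q})\mapsto(f_1(x_1),f_2(x_2),\mathbb{R})$. Then $\Gamma$ is a functor from $\mathbf{Qtp}$ to $\mathbf{P}$ (in particular each $\Gamma\mathbb{Q}$ is a semisymmetric quasigroup and each $\Gamma(f_1,f_2,f_3)$ is a homomorphism), it is one-one on objects, and $\mathbf{Qtp}$ is isomorphic, via $\Gamma$, to a subcategory of $\mathbf{P}$, namely the image of $\Gamma$.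
   Context: A quasigroup is an algebra $\mathbb{Q}=(Q;\cdot,/,\backslash)$ with three binary operations satisfying $(x\cdot y)/y=x$, $x\backslash(x\cdot y)=y$, $(x/y)\cdot y=x$, $x\cdot(x\backslash y)=y$. Dual division operations are defined by $x/\!/y=y/x$ and $x\backslash\!\backslash y=y\backslash x$. A quasigroup is semisymmetric if it satisfies $x\cdot(y\cdot x)=y$ (equivalently $x/y=x\backslash y=y\cdot x$; so a semisymmetric quasigroup is determined by its multiplication, and we specify it by giving the multiplication only). A homomorphism of quasigroups is a function $f$ with $f(x)\cdot f(y)=f(x\cdot y)$. A homotopy from $\mathbb{Q}$ to $\mathbb{R}$ is a triple $(f_1,f_2,f_3)$ of functions $f_i:Q\to R$ with $f_1(x)\cdot f_2(y)=f_3(x\cdot y)$ for all $x,y\in Q$. $\mathbf{Qtp}$ is the category whose objects are all small quasigroups and whose arrows are homotopies, with componentwise composition and identities. $\mathbf{P}$ is the category whose objects are all small semisymmetric quasigroups and whose arrows are quasigroup homomorphisms. *)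

(* Defs.v *)
From HB Require Import structures.
From mathcomp Require Import all_boot.
From mathcomp Require Import boolp.

Set Implicit Arguments.
Unset Strict Implicit.
Unset Printing Implicit Defensive.

Local Open Scope quotient_scope.

(* The tag Q in the base set Q^2 x {Q} requires sets that may be elements of
   other sets, and injectivity on objects requires base sets that can be usefully
   compared for equality, which Rocq types cannot.  Small sets are therefore
   elements of Aczel's cumulative hierarchy: well-founded trees branching over
   the types of a universe, modulo bisimulation.  The quotient makes extensional
   equality of sets coincide with Leibniz equality (vset_ext). *)

Inductive tree : Type := Tree (I : Type) of (I -> tree).

Definition branch (t : tree) : Type := let: Tree T _ := t in T.
Definition child (t : tree) : branch t -> tree :=
  let: Tree _ f := t in f.

Fixpoint bisim (s t : tree) {struct s} : Prop :=
  match s, t with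
  | Tree _ f, Tree _ g =>
      (forall i, exists j, bisim (f i) (g j)) /\
      (forall j, exists i, bisim (f i) (g j))
  end.

Lemma bisim_refl s : bisim s s.
Proof. by elim: s => I f IH /=; split=> i; exists i. Qed.

Lemma bisim_sym s t : bisim s t -> bisim t s.
Proof.
elim: s t => I f IH [J g] /= [fg gf]; split.
  by move=> j; have [i ij] := gf j; exists i; apply: IH.
by move=> i; have [j ij] := fg i; exists j; apply: IH.
Qed.

Lemma bisim_trans s t u : bisim s t -> bisim t u -> bisim s u.
Proof.
elim: s t u => I f IH [J g] [K h] /= [fg gf] [gh hg]; split.
  move=> i; have [j ij] := fg i; have [k jk] := gh j.
  by exists k; apply: IH jk.
move=> k; have [j jk] := hg k; have [i ij] := gf j.
by exists i; apply: IH jk.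
Qed.

HB.instance Definition _ := gen_eqMixin tree.
HB.instance Definition _ := gen_choiceMixin tree.

Definition bisimb : rel tree := fun s t => `[< bisim s t >].

Lemma bisimb_refl : reflexive bisimb.
Proof. by move=> s; apply/asboolP; apply: bisim_refl. Qed.

Lemma bisimb_sym : symmetric bisimb.
Proof. by move=> s t; apply/asboolP/asboolP; apply: bisim_sym. Qed.

Lemma bisimb_trans : transitive bisimb.
Proof.
move=> t s u /asboolP st /asboolP tu; apply/asboolP.
exact: bisim_trans st tu.
Qed.

Canonical bisim_equiv := EquivRel bisimb bisimb_refl bisimb_sym bisimb_trans.

Definition vset : Type := {eq_quot bisim_equiv}.

Definition vpi (t : tree) : vset := \pi_({eq_quot bisim_equiv}) t.
Definition vrepr (a : vset) : tree := repr (a : {eq_quot bisim_equiv}).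

Lemma vreprK a : vpi (vrepr a) = a.
Proof. exact: reprK. Qed.

Lemma vpiP s t : vpi s = vpi t <-> bisim s t.
Proof.
split=> [/eqmodP/asboolP // | st].
by apply/eqmodP; apply/asboolP.
Qed.

(* A small type enumerating the elements of a. *)
Definition vindex (a : vset) : Type := branch (vrepr a).
Definition velem (a : vset) (i : vindex a) : vset := vpi (child i).

Definition vmem (x a : vset) : Prop := exists i : vindex a, x = velem i.

Declare Scope vset_scope.
Delimit Scope vset_scope with V.
Notation "x ∈ a" := (vmem x a) (at level 70, no associativity) : vset_scope.
Local Open Scope vset_scope.

Lemma vset_ext (a b : vset) : (forall x, x ∈ a <-> x ∈ b) -> a = b.
Proof.
move=> ab; rewrite -(vreprK a) -(vreprK b); apply/vpiP.
have ha i : exists j, bisim (@child (vrepr a) i) (@child (vrepr b) j).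
  have /ab[j e] : @velem a i ∈ a by exists i.
  by exists j; apply/vpiP.
have hb j : exists i, bisim (@child (vrepr a) i) (@child (vrepr b) j).
  have /ab[i e] : @velem b j ∈ b by exists j.
  by exists i; apply/vpiP; symmetry.
rewrite /velem /vindex in ha hb.
by case: (vrepr a) (vrepr b) ha hb => I f [J g].
Qed.

(* Replacement: the set of values of a family indexed by a small type. *)
Definition vrange (I : Type) (f : I -> vset) : vset :=
  vpi (Tree (fun i => vrepr (f i))).

Lemma in_vrange (I : Type) (f : I -> vset) x :
  x ∈ vrange f <-> exists i, x = f i.
Proof.
have : bisim (vrepr (vrange f)) (Tree (fun i => vrepr (f i))).
  by apply/vpiP; rewrite vreprK.
rewrite /vmem /velem /vindex.
case: (vrepr (vrange f)) => J g /= [gf fg]; split=> -[].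
  move=> j ->; have [i ji] := gf j; exists i.
  by rewrite -[RHS]vreprK; apply/vpiP.
move=> i ->; have [j ji] := fg i; exists j.
by rewrite -[LHS]vreprK; symmetry; apply/vpiP.
Qed.

Definition vupair (x y : vset) : vset :=
  vrange (fun b : bool => if b then x else y).
Definition vsing (x : vset) : vset := vupair x x.
Definition vpair (x y : vset) : vset := vupair (vsing x) (vupair x y).
Definition vprod (a b : vset) : vset :=
  vrange (fun p : vindex a * vindex b => vpair (velem p.1) (velem p.2)).
Definition vsep (a : vset) (P : vset -> Prop) : vset :=
  vrange (fun i : {i : vindex a | P (velem i)} => velem (sval i)).

Lemma in_vupair x y z : z ∈ vupair x y <-> z = x \/ z = y.
Proof.
rewrite in_vrange; split=> [[[] ->]|[] ->]; [by left|by right|..].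
  by exists true.
by exists false.
Qed.

Lemma in_vsing x z : z ∈ vsing x <-> z = x.
Proof. by rewrite in_vupair; split=> [[]|] //; left. Qed.

Lemma vpair_inj x y x' y' : vpair x y = vpair x' y' <-> x = x' /\ y = y'.
Proof.
split=> [e|[-> ->] //].
have ex : x = x'.
  have : vsing x ∈ vpair x' y' by rewrite -e in_vupair; left.
  rewrite in_vupair => -[] e1.
    by apply/in_vsing; rewrite -e1 in_vsing.
  have : x' ∈ vsing x by rewrite e1 in_vupair; left.
  by rewrite in_vsing.
subst x'; split=> //.
have hy : vupair x y ∈ vpair x y' by rewrite -e in_vupair; right.
have hy' : vupair x y' ∈ vpair x y by rewrite e in_vupair; right.
have iy : y ∈ vupair x y by rewrite in_vupair; right.
have iy' : y' ∈ vupair x y' by rewrite in_vupair; right.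
have [yx | yx] : y = x \/ y = y'.
- by move: iy; case/in_vupair: hy => -> => [/in_vsing|/in_vupair[]]; auto.
- have : y' ∈ vsing x.
    by move: iy' hy'; rewrite yx => iy' /in_vupair[] => [<-|e'] //; move: iy'; rewrite e'.
  by rewrite yx => /in_vsing.
- by [].
Qed.

Lemma in_vprod a b z :
  z ∈ vprod a b <-> exists x y, [/\ x ∈ a, y ∈ b & z = vpair x y].
Proof.
rewrite in_vrange; split=> [[[i j] ->] | [x [y [[i ->] [j ->] ->]]]].
  by exists (velem i), (velem j); split=> //; [exists i | exists j].
by exists (i, j).
Qed.

Lemma in_vsep a P z : z ∈ vsep a P <-> z ∈ a /\ P z.
Proof.
rewrite in_vrange; split=> [[[i Pi] ->] | [[i ->] Pi]].
  by split=> //; exists i.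
by exists (exist _ i Pi).
Qed.

Record elt (a : vset) := Elt { eltval :> vset; eltP : eltval ∈ a }.

Record algebra := Algebra {
  base :> vset;
  mul : elt base -> elt base -> elt base;
  rdiv : elt base -> elt base -> elt base;
  ldiv : elt base -> elt base -> elt base }.

Declare Scope quasigroup_scope.
Delimit Scope quasigroup_scope with Q.
Notation "x · y" := (mul x y) (at level 40, left associativity) : quasigroup_scope.
Local Open Scope quasigroup_scope.

(* rdiv x y is x / y and ldiv x y is x \ y; dual_rdiv and dual_ldiv are the dual
   divisions x // y = y / x and x \\ y = y \ x. *)
Definition dual_rdiv (A : algebra) (x y : elt A) : elt A := rdiv y x.
Definition dual_ldiv (A : algebra) (x y : elt A) : elt A := ldiv y x.

Definition is_quasigroup (A : algebra) : Prop :=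
  forall x y : elt A,
    [/\ rdiv (x · y) y = x, ldiv x (x · y) = y,
        rdiv x y · y = x & x · ldiv x y = y].

Definition is_semisymmetric (A : algebra) : Prop :=
  forall x y : elt A, x · (y · x) = y.

Record quasigroup := Quasigroup {
  quasigroup_algebra :> algebra;
  quasigroupP : is_quasigroup quasigroup_algebra }.

Record ssquasigroup := SSQuasigroup {
  ssquasigroup_quasigroup :> quasigroup;
  ssquasigroupP : is_semisymmetric ssquasigroup_quasigroup }.

(* The algebra (Q; ., /, \) as a set, with the operations as sets of pairs
   ((x, y), z). *)
Definition graph2 (a : vset) (op : elt a -> elt a -> elt a) : vset :=
  vsep (vprod (vprod a a) a)
       (fun t => exists x y : elt a, t = vpair (vpair x y) (op x y)).

Definition algebra_set (A : algebra) : vset :=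
  vpair A (vpair (graph2 (@mul A)) (vpair (graph2 (@rdiv A)) (graph2 (@ldiv A)))).

Record homomorphism (A B : algebra) := Homomorphism {
  hom_fun :> elt A -> elt B;
  homP : forall x y, hom_fun x · hom_fun y = hom_fun (x · y) }.

Record homotopy (A B : algebra) := Homotopy {
  htp1 : elt A -> elt B;
  htp2 : elt A -> elt B;
  htp3 : elt A -> elt B;
  htpP : forall x y, htp1 x · htp2 y = htp3 (x · y) }.

Record category := Category {
  obj :> Type;
  arr : obj -> obj -> Type;
  idc : forall X, arr X X;
  comp : forall X Y Z, arr Y Z -> arr X Y -> arr X Z;
  comp_idl : forall X Y (f : arr X Y), comp (idc Y) f = f;
  comp_idr : forall X Y (f : arr X Y), comp f (idc X) = f;
  comp_assoc : forall X Y Z W (f : arr X Y) (g : arr Y Z) (h : arr Z W),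
    comp h (comp g f) = comp (comp h g) f }.

Record functor (C D : category) := Functor {
  fobj :> C -> D;
  farr : forall X Y : C, arr X Y -> arr (fobj X) (fobj Y);
  farr_id : forall X : C, farr (idc X) = idc (fobj X);
  farr_comp : forall (X Y Z : C) (f : arr X Y) (g : arr Y Z),
    farr (comp g f) = comp (farr g) (farr f) }.

Definition functor_id (C : category) : functor C C :=
  @Functor C C (fun X => X) (fun X Y f => f) (fun X => erefl)
    (fun X Y Z f g => erefl).

Lemma functor_comp_id (C D E : category) (G : functor D E) (F : functor C D) X :
  farr G (farr F (idc X)) = idc (G (F X)).
Proof. by rewrite !farr_id. Qed.

Lemma functor_comp_comp (C D E : category) (G : functor D E) (F : functor C D)
    (X Y Z : C) (f : arr X Y) (g : arr Y Z) :
  farr G (farr F (comp g f)) = comp (farr G (farr F g)) (farr G (farr F f)).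
Proof. by rewrite !farr_comp. Qed.

Definition functor_comp (C D E : category) (G : functor D E) (F : functor C D) :
    functor C E :=
  @Functor C E (fun X => G (F X)) (fun X Y f => farr G (farr F f))
    (functor_comp_id G F) (@functor_comp_comp C D E G F).

Definition is_isomorphism (C D : category) (F : functor C D) : Prop :=
  exists G : functor D C,
    functor_comp G F = functor_id C /\ functor_comp F G = functor_id D.

Record subcategory (C : category) := Subcategory {
  sub_obj : C -> Prop;
  sub_arr : forall X Y : C, arr X Y -> Prop;
  sub_dom : forall (X Y : C) (f : arr X Y), sub_arr f -> sub_obj X;
  sub_cod : forall (X Y : C) (f : arr X Y), sub_arr f -> sub_obj Y;
  sub_id : forall X : C, sub_obj X -> sub_arr (idc X);
  sub_comp : forall (X Y Z : C) (f : arr X Y) (g : arr Y Z),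
    sub_arr f -> sub_arr g -> sub_arr (comp g f) }.

Section SubCategory.
Variables (C : category) (S : subcategory C).

Record subcat_obj := SubObj { sub_objval :> C; sub_objP : sub_obj S sub_objval }.

Record subcat_arr (X Y : subcat_obj) := SubArr {
  sub_arrval :> arr (sub_objval X) (sub_objval Y);
  sub_arrP : sub_arr S sub_arrval }.

Lemma sub_arrval_inj X Y (f g : subcat_arr X Y) :
  sub_arrval f = sub_arrval g -> f = g.
Proof.
case: f g => f fP [g gP] /= e; subst g.
by rewrite (Prop_irrelevance fP gP).
Qed.

Definition subcat_id (X : subcat_obj) : subcat_arr X X :=
  SubArr (sub_id (sub_objP X)).

Definition subcat_comp (X Y Z : subcat_obj) (g : subcat_arr Y Z)
    (f : subcat_arr X Y) : subcat_arr X Z :=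
  SubArr (sub_comp (sub_arrP f) (sub_arrP g)).

Definition subcat : category.
Proof.
refine (@Category subcat_obj subcat_arr subcat_id subcat_comp _ _ _).
- by move=> X Y f; apply: sub_arrval_inj; apply: comp_idl.
- by move=> X Y f; apply: sub_arrval_inj; apply: comp_idr.
- by move=> X Y Z W f g h; apply: sub_arrval_inj; apply: comp_assoc.
Defined.

Definition subcat_incl : functor subcat C :=
  @Functor subcat C sub_objval (fun X Y f => sub_arrval f)
    (fun X => erefl) (fun X Y Z f g => erefl).

End SubCategory.

(* Being an inductive family, image_arr F g says that g is some F f up to the
   required identification of the endpoints of g with objects F A and F B. *)
Inductive image_arr (C D : category) (F : functor C D) :
    forall X Y : D, arr X Y -> Prop :=
  ImageArr (A B : C) (f : arr A B) : @image_arr C D F (F A) (F B) (farr F f).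
Arguments image_arr {C D} F {X Y} _.

Lemma homotopy_eq (A B : algebra) (f g : homotopy A B) :
  htp1 f = htp1 g -> htp2 f = htp2 g -> htp3 f = htp3 g -> f = g.
Proof.
case: f g => f1 f2 f3 fP [g1 g2 g3 gP] /= e1 e2 e3; subst g1 g2 g3.
by rewrite (Prop_irrelevance fP gP).
Qed.

Lemma homomorphism_eq (A B : algebra) (f g : homomorphism A B) :
  hom_fun f = hom_fun g -> f = g.
Proof.
case: f g => f fP [g gP] /= e; subst g.
by rewrite (Prop_irrelevance fP gP).
Qed.

Definition homotopy_id (A : algebra) : homotopy A A :=
  @Homotopy A A id id id (fun x y => erefl).

Definition homotopy_comp (A B C : algebra) (g : homotopy B C)
  (f : homotopy A B) : homotopy A C.
Proof.
refine (@Homotopy A C (htp1 g \o htp1 f) (htp2 g \o htp2 f) (htp3 g \o htp3 f) _).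
by move=> x y /=; rewrite htpP htpP.
Defined.

Definition homomorphism_id (A : algebra) : homomorphism A A :=
  @Homomorphism A A id (fun x y => erefl).

Definition homomorphism_comp (A B C : algebra) (g : homomorphism B C)
  (f : homomorphism A B) : homomorphism A C.
Proof.
refine (@Homomorphism A C (hom_fun g \o hom_fun f) _).
by move=> x y /=; rewrite homP homP.
Defined.

Definition Qtp : category.
Proof.
refine (@Category quasigroup (fun Q R => homotopy Q R)
  (fun Q => homotopy_id Q) (fun Q R S g f => homotopy_comp g f) _ _ _).
- by move=> Q R f; apply: homotopy_eq.
- by move=> Q R f; apply: homotopy_eq.
- by move=> Q R S T f g h; apply: homotopy_eq.
Defined.

Definition Pcat : category.
Proof.
refine (@Category ssquasigroup (fun Q R => homomorphism Q R)
  (fun Q => homomorphism_id Q) (fun Q R S g f => homomorphism_comp g f) _ _ _).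
- by move=> Q R f; apply: homomorphism_eq.
- by move=> Q R f; apply: homomorphism_eq.
- by move=> Q R S T f g h; apply: homomorphism_eq.
Defined.

Definition Gamma_base (Q : quasigroup) : vset :=
  vprod (vprod Q Q) (vsing (algebra_set Q)).

(* triple Q x1 x2 is (x1, x2, Q). *)
Definition triple (Q : quasigroup) (x1 x2 : elt Q) : vset :=
  vpair (vpair x1 x2) (algebra_set Q).
Arguments triple : clear implicits.

Lemma in_Gamma_base (Q : quasigroup) z :
  z ∈ Gamma_base Q <-> exists x1 x2 : elt Q, z = triple Q x1 x2.
Proof.
rewrite in_vprod; split=> [[p [t []]] | [x1 [x2 ->]]].
  rewrite in_vprod in_vsing => -[x1 [x2 [h1 h2 ->]]] -> ->.
  by exists (Elt h1), (Elt h2).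
exists (vpair x1 x2), (algebra_set Q); split=> //.
  by rewrite in_vprod; exists x1, x2; split=> //; apply: eltP.
by rewrite in_vsing.
Qed.

(* Main.v *)
(* The tag makes Gamma one-one on objects, except possibly on quasigroups with
   empty base, of which there is only one.  It is faithful because the third
   component of a homotopy is determined by the other two, every z being the
   product z · (z \ z).  A faithful functor that is one-one on objects has an image
   closed under composition, and is an isomorphism onto it. *)

Require Import Defs.
From mathcomp Require Import all_boot.
From mathcomp Require Import boolp.

Local Open Scope quasigroup_scope.
Local Open Scope vset_scope.

Set Implicit Arguments.
Unset Strict Implicit.
Unset Printing Implicit Defensive.

(** * Functors that are one-one on objects *)

(** Functors that agree on objects send an arrow to hom-types with only provably equal endpoints;
    comparing the values requires transport along these equalities. *)
Definition arr_cast (C : category) (X X' Y Y' : C) (eX : X = X') (eY : Y = Y')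
    (f : arr X Y) : arr X' Y' :=
  match eX in _ = X', eY in _ = Y' return arr X' Y' with erefl, erefl => f end.

(** By proof irrelevance every loop at an object is [erefl], so it does not matter how the equality
    was obtained. *)
Lemma arr_cast_irr (C : category) (X Y : C) (eX : X = X) (eY : Y = Y)
  (f : arr X Y) : arr_cast eX eY f = f.
Proof. by rewrite (Prop_irrelevance eX erefl) (Prop_irrelevance eY erefl). Qed.

Lemma arr_cast_trans (C : category) (X X' X'' Y Y' Y'' : C)
    (eX : X = X') (eX' : X' = X'') (eY : Y = Y') (eY' : Y' = Y'') (f : arr X Y) :
  arr_cast eX' eY' (arr_cast eX eY f)
    = arr_cast (etrans eX eX') (etrans eY eY') f.
Proof. by subst. Qed.

Lemma arr_cast_id (C : category) (X X' : C) (e e' : X = X') :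
  arr_cast e e' (idc X) = idc X'.
Proof. by subst; rewrite arr_cast_irr. Qed.

Lemma arr_cast_comp (C : category) (X X' Y Y' Z Z' : C)
    (eX : X = X') (eY : Y = Y') (eZ : Z = Z') (f : arr X Y) (g : arr Y Z) :
  arr_cast eX eZ (Defs.comp g f) = Defs.comp (arr_cast eY eZ g) (arr_cast eX eY f).
Proof. by subst. Qed.

Lemma farr_cast (C D : category) (F : functor C D) (X X' Y Y' : C)
    (eX : X = X') (eY : Y = Y') (f : arr X Y) :
  farr F (arr_cast eX eY f)
    = arr_cast (congr1 (fobj F) eX) (congr1 (fobj F) eY) (farr F f).
Proof. by subst. Qed.

(** Once the object maps are identified by extensionality, each [e X] is a loop and the casts
    disappear. *)
Lemma functor_eq (C D : category) (F G : functor C D)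
    (e : forall X, F X = G X) :
  (forall X Y (f : arr X Y), arr_cast (e X) (e Y) (farr F f) = farr G f) ->
  F = G.
Proof.
case: F G e => Fo Fa F1 Fc [Go Ga G1 Gc] /= e.
have eo : Fo = Go by apply: funext.
subst Go => ea.
have {}ea : Fa = Ga.
  apply: functional_extensionality_dep => X.
  apply: functional_extensionality_dep => Y.
  by apply: funext => f; rewrite -ea arr_cast_irr.
subst Ga.
by rewrite (Prop_irrelevance F1 G1) (Prop_irrelevance Fc Gc).
Qed.

(** * A criterion for isomorphism of categories *)

Definition faithful (C D : category) (F : functor C D) : Prop :=
  forall (X Y : C) (f g : arr X Y), farr F f = farr F g -> f = g.

Definition full (C D : category) (F : functor C D) : Prop :=
  forall (X Y : C) (g : arr (F X) (F Y)), exists f : arr X Y, farr F f = g.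

(** The inverse takes chosen preimages of objects and, by fullness, of arrows; faithfulness makes
    the preimages of arrows unique, whence functoriality and both inverse laws. *)
Lemma bijective_fully_faithful_isomorphism (C D : category) (F : functor C D) :
  injective (fobj F) -> (forall Y : D, exists X : C, F X = Y) ->
  faithful F -> full F -> is_isomorphism F.
Proof.
move=> Finj Fsurj Ffaith Ffull.
have [K FK] := choice Fsurj.
(* Fullness speaks only of arrows between values of [F], so [g] is first transported to run from
   [F (K X)] to [F (K Y)]. *)
pose lift X Y (g : arr X Y) : {f : arr (K X) (K Y) |
    farr F f = arr_cast (esym (FK X)) (esym (FK Y)) g} :=
  cid (Ffull _ _ _).
have G1 X : sval (lift X X (idc X)) = idc (K X).
  by apply: Ffaith; rewrite (svalP (lift _ _ _)) farr_id arr_cast_id.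
have Gc X Y Z (f : arr X Y) (g : arr Y Z) :
    sval (lift _ _ (Defs.comp g f)) = Defs.comp (sval (lift _ _ g)) (sval (lift _ _ f)).
  apply: Ffaith; rewrite farr_comp !(svalP (lift _ _ _)).
  exact: arr_cast_comp.
pose G := @Functor D C K (fun X Y g => sval (lift X Y g)) G1 Gc.
have GF X : K (F X) = X by apply: Finj; rewrite FK.
exists G; split.
  apply: (@functor_eq C C (functor_comp G F) (functor_id C) GF) => X Y f /=.
  apply: Ffaith.
  by rewrite farr_cast (svalP (lift _ _ _)) arr_cast_trans arr_cast_irr.
apply: (@functor_eq D D (functor_comp F G) (functor_id D) FK) => X Y f /=.
by rewrite (svalP (lift _ _ _)) arr_cast_trans arr_cast_irr.
Qed.

(** The equalities of endpoints become explicit, which allows inversion when the endpoints are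
    already of the form [F A]. *)
Lemma image_arrP (C D : category) (F : functor C D) (X Y : D) (g : arr X Y) :
  image_arr F g <->
  exists (A B : C) (f : arr A B) (eA : F A = X) (eB : F B = Y),
    g = arr_cast eA eB (farr F f).
Proof.
split=> [[A B f]|[A [B [f [eA [eB ->]]]]]]; first by exists A, B, f, erefl, erefl.
by subst; apply: ImageArr.
Qed.

(** * The image as a subcategory, and the corestriction to it *)

Section Image.
Variables (C D : category) (F : functor C D) (Finj : injective (fobj F)).

Let image_obj (X : D) : Prop := exists A : C, F A = X.

Lemma image_dom (X Y : D) (g : arr X Y) : image_arr F g -> image_obj X.
Proof. by case=> A B f; exists A. Qed.

Lemma image_cod (X Y : D) (g : arr X Y) : image_arr F g -> image_obj Y.
Proof. by case=> A B f; exists B. Qed.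

Lemma image_id (X : D) : image_obj X -> image_arr F (idc X).
Proof. by case=> A <-; rewrite -farr_id; apply: ImageArr. Qed.

Lemma image_comp (X Y Z : D) (f : arr X Y) (g : arr Y Z) :
  image_arr F f -> image_arr F g -> image_arr F (Defs.comp g f).
Proof.
move=> imf; case: X Y f / imf g => A B f g.
(* The two preimages may meet at different objects [B] and [B'] with [F B' = F B]; injectivity makes
   them composable in [C]. *)
case/image_arrP=> B' [E [h [eB [eE ->]]]]; have ? := Finj eB; subst B' Z.
by rewrite arr_cast_irr -farr_comp; apply: ImageArr.
Qed.

Definition image_subcategory : subcategory D :=
  @Subcategory D image_obj (fun X Y g => image_arr F g)
    image_dom image_cod image_id image_comp.

Definition corestr_obj (A : C) : subcat image_subcategory :=
  @SubObj D image_subcategory (F A) (ex_intro _ A erefl).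

Definition corestr_arr (A B : C) (f : arr A B) :
    arr (corestr_obj A) (corestr_obj B) :=
  @SubArr D image_subcategory (corestr_obj A) (corestr_obj B) (farr F f) (ImageArr F f).

Lemma corestr_id (A : C) : corestr_arr (idc A) = idc (corestr_obj A).
Proof. by apply: sub_arrval_inj; apply: farr_id. Qed.

Lemma corestr_comp (A B E : C) (f : arr A B) (g : arr B E) :
  corestr_arr (Defs.comp g f) = Defs.comp (corestr_arr g) (corestr_arr f).
Proof. by apply: sub_arrval_inj; apply: farr_comp. Qed.

Definition corestr : functor C (subcat image_subcategory) :=
  @Functor C (subcat image_subcategory) corestr_obj corestr_arr corestr_id corestr_comp.

Lemma incl_corestr : functor_comp (subcat_incl image_subcategory) corestr = F.
Proof.
by apply: (@functor_eq C D (functor_comp (subcat_incl image_subcategory) corestr) F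
  (fun X => erefl)) => X Y f.
Qed.

Lemma corestr_isomorphism : faithful F -> is_isomorphism corestr.
Proof.
move=> Ffaith; apply: bijective_fully_faithful_isomorphism.
- by move=> A B /(congr1 (@sub_objval D image_subcategory)) /Finj.
- case=> X XP; case: (XP) => A eA; exists A; subst X.
  by rewrite /= /corestr_obj; congr SubObj; apply: Prop_irrelevance.
- by move=> A B f g /(congr1 (fun h => sub_arrval h)) /Ffaith.
- move=> A B [g gP]; case/image_arrP: (gP) => A' [B' [f [eA [eB eg]]]].
  (* The arrow has a preimage between some [A'] and [B']; injectivity on objects places it between
     [A] and [B]. *)
  have ? := Finj eA; have ? := Finj eB; subst A' B'.
  by exists f; apply: sub_arrval_inj; rewrite /= eg arr_cast_irr.
Qed.

End Image.

(** * Algebras as sets *)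

Lemma eltval_inj (a : vset) : injective (@eltval a).
Proof.
by case=> x xP [y yP] /= e; subst y; rewrite (Prop_irrelevance xP yP).
Qed.

(** The point of the graph of [op] over [(x, y)] lies in the graph of [op'], where [(x, y)]
    determines the value. *)
Lemma graph2_inj (a : vset) : injective (@graph2 a).
Proof.
move=> op op' e; apply: funext => x; apply: funext => y.
have : vpair (vpair x y) (op x y) ∈ graph2 op.
  rewrite in_vsep; split; last by exists x, y.
  rewrite in_vprod; exists (vpair x y), (op x y); split=> //; last exact: eltP.
  by rewrite in_vprod; exists x, y; split=> //; apply: eltP.
rewrite e in_vsep => -[_ [x' [y' /vpair_inj[/vpair_inj[ex ey] eop]]]].
apply: eltval_inj; rewrite eop.
by rewrite (eltval_inj ex) (eltval_inj ey).
Qed.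

Lemma algebra_set_inj : injective algebra_set.
Proof.
case=> a m r l [a' m' r' l'] /vpair_inj[/= ea]; subst a'.
by case/vpair_inj=> /graph2_inj-> /vpair_inj[/graph2_inj-> /graph2_inj->].
Qed.

(** Set extensionality identifies the bases, and operations without arguments agree vacuously. *)
Lemma empty_algebra_eq (A B : algebra) :
  (elt A -> False) -> (elt B -> False) -> A = B.
Proof.
case: A B => a m r l [b m' r' l'] /= a0 b0.
have ? : a = b.
  by apply: vset_ext => x; split=> h; [case: a0|case: b0]; exists x.
by subst b; congr Algebra; apply: funext => x; case: a0.
Qed.

Lemma quasigroup_eq (Q R : quasigroup) : Q = R :> algebra -> Q = R.
Proof.
case: Q R => A AP [B BP] /= e; subst B.
by rewrite (Prop_irrelevance AP BP).
Qed.

Lemma semisymmetric_quasigroup (A : algebra) :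
  is_semisymmetric A ->
  (forall x y : elt A, rdiv x y = y · x) ->
  (forall x y : elt A, ldiv x y = y · x) -> is_quasigroup A.
Proof.
move=> ss er el x y.
(* Writing the last [u] as [v · (u · v)] turns this into semisymmetry for [u · v] and [v]. *)
have ss' (u v : elt A) : u · v · u = v by rewrite -{2}(ss v u) ss.
by rewrite er er el el; split.
Qed.

(** * The functor Gamma *)

Section GammaObject.
Variable Q : quasigroup.

Definition gpair (x1 x2 : elt Q) : elt (Gamma_base Q) :=
  Elt ((in_Gamma_base Q (triple Q x1 x2)).2
    (ex_intro _ x1 (ex_intro _ x2 erefl))).

Lemma gpair_surj (u : elt (Gamma_base Q)) :
  exists p : elt Q * elt Q, u = gpair p.1 p.2.
Proof.
have [x1 [x2 e]] := (in_Gamma_base Q u).1 (eltP u).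
by exists (x1, x2); apply: eltval_inj.
Qed.

(** The coordinates are extracted by choice; injectivity of pairing makes them the expected ones. *)
Definition gfst (u : elt (Gamma_base Q)) : elt Q := (sval (cid (gpair_surj u))).1.
Definition gsnd (u : elt (Gamma_base Q)) : elt Q := (sval (cid (gpair_surj u))).2.

Lemma gpairK (u : elt (Gamma_base Q)) : gpair (gfst u) (gsnd u) = u.
Proof. by rewrite /gfst /gsnd; case: cid. Qed.

Lemma gpair_inj (x1 x2 y1 y2 : elt Q) :
  gpair x1 x2 = gpair y1 y2 -> x1 = y1 /\ x2 = y2.
Proof.
move/(congr1 (@eltval _))/vpair_inj => [/vpair_inj[e1 e2] _].
by split; apply: eltval_inj.
Qed.

Lemma gfst_pair (x1 x2 : elt Q) : gfst (gpair x1 x2) = x1.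
Proof. by have [] := gpair_inj (gpairK (gpair x1 x2)). Qed.

Lemma gsnd_pair (x1 x2 : elt Q) : gsnd (gpair x1 x2) = x2.
Proof. by have [] := gpair_inj (gpairK (gpair x1 x2)). Qed.

Definition gmul (u v : elt (Gamma_base Q)) : elt (Gamma_base Q) :=
  gpair (dual_rdiv (gsnd u) (gfst u · gsnd v))
        (dual_ldiv (gfst u · gsnd v) (gfst v)).

(** Semisymmetry forces both divisions to be the multiplication with its arguments swapped. *)
Definition Gamma_algebra : algebra :=
  @Algebra (Gamma_base Q) gmul (fun u v => gmul v u) (fun u v => gmul v u).

(** With $q = y_1 \cdot x_2$, the inner product is $(q/y_2, x_1 \backslash q)$. Since $x_1 \cdot
    (x_1 \backslash q) = q$, the outer one is $(q/x_2, (q/y_2) \backslash q) = (y_1, y_2)$. *)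
Lemma Gamma_semisymmetric : is_semisymmetric Gamma_algebra.
Proof.
move=> u v /=; rewrite /gmul !gfst_pair !gsnd_pair /dual_rdiv /dual_ldiv.
set x1 := gfst u; set x2 := gsnd u; set y1 := gfst v; set y2 := gsnd v.
have [_ _ _ ->] := quasigroupP x1 (y1 · x2).
have [-> _ _ _] := quasigroupP y1 x2.
have [_ _ e _] := quasigroupP (y1 · x2) y2.
(* The second $q$ is written as $(q/y_2) \cdot y_2$, so that left division by $q/y_2$ cancels. *)
rewrite -{2}e.
by have [_ -> _ _] := quasigroupP (rdiv (y1 · x2) y2) y2; rewrite gpairK.
Qed.

Definition Gamma_obj : ssquasigroup :=
  @SSQuasigroup
    (Quasigroup (semisymmetric_quasigroup Gamma_semisymmetric
       (fun _ _ => erefl) (fun _ _ => erefl)))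
    Gamma_semisymmetric.

End GammaObject.

(** * The action on homotopies *)

Section GammaArrow.
Variables (Q R : quasigroup) (f : homotopy Q R).

Definition gmap (u : elt (Gamma_base Q)) : elt (Gamma_base R) :=
  gpair (htp1 f (gfst u)) (htp2 f (gsnd u)).

(** Apply the homotopy to $z = (z/y) \cdot y$ and divide by $f_2(y)$ on the right; [htp2_ldiv] is
    the mirror image. *)
Lemma htp1_rdiv (z y : elt Q) : htp1 f (rdiv z y) = rdiv (htp3 f z) (htp2 f y).
Proof.
have [_ _ e _] := quasigroupP z y; rewrite -{2}e -htpP.
by have [-> _ _ _] := quasigroupP (htp1 f (rdiv z y)) (htp2 f y).
Qed.

Lemma htp2_ldiv (x z : elt Q) : htp2 f (ldiv x z) = ldiv (htp1 f x) (htp3 f z).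
Proof.
have [_ _ _ e] := quasigroupP x z; rewrite -{2}e -htpP.
by have [_ -> _ _] := quasigroupP (htp1 f x) (htp2 f (ldiv x z)).
Qed.

(** The coordinates of a product are $(x_1 \cdot y_2)/x_2$ and $y_1 \backslash (x_1 \cdot y_2)$; the
    division rules carry $f_1$ and $f_2$ to $f_3(x_1 \cdot y_2) = f_1(x_1) \cdot f_2(y_2)$. *)
Lemma gmapM (u v : elt (Gamma_base Q)) : gmul (gmap u) (gmap v) = gmap (gmul u v).
Proof.
rewrite /gmap /gmul !gfst_pair !gsnd_pair /dual_rdiv /dual_ldiv.
by rewrite htp1_rdiv htp2_ldiv htpP.
Qed.

Definition Gamma_arr : homomorphism (Gamma_obj Q) (Gamma_obj R) :=
  @Homomorphism (Gamma_obj Q) (Gamma_obj R) gmap gmapM.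

End GammaArrow.

Lemma Gamma_arr_id (Q : quasigroup) :
  Gamma_arr (homotopy_id Q) = homomorphism_id (Gamma_obj Q).
Proof. by apply: homomorphism_eq; apply: funext => u; apply: gpairK. Qed.

Lemma Gamma_arr_comp (Q R S : quasigroup) (f : homotopy Q R) (g : homotopy R S) :
  Gamma_arr (homotopy_comp g f) = homomorphism_comp (Gamma_arr g) (Gamma_arr f).
Proof.
apply: homomorphism_eq; apply: funext => u.
by rewrite /= /gmap gfst_pair gsnd_pair.
Qed.

Definition Gamma : functor Qtp Pcat :=
  @Functor Qtp Pcat Gamma_obj Gamma_arr Gamma_arr_id Gamma_arr_comp.

(** * Injectivity on objects and faithfulness *)

Lemma Gamma_base_tag (Q R : quasigroup) :
  Gamma_base Q = Gamma_base R -> elt Q -> Q = R.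
Proof.
move=> e x; apply: quasigroup_eq; apply: algebra_set_inj.
(* Any element of the common base would do; its last coordinate is both [algebra_set Q] and
   [algebra_set R]. *)
have : triple Q x x ∈ Gamma_base R by rewrite -e; apply: eltP (gpair x x).
by case/in_Gamma_base => y1 [y2 /vpair_inj[]].
Qed.

Lemma Gamma_base_inj : injective Gamma_base.
Proof.
move=> Q R e.
have [[x]|Q0] := pselect (inhabited (elt Q)); first exact: Gamma_base_tag x.
have [[x]|R0] := pselect (inhabited (elt R)).
  by symmetry; apply: Gamma_base_tag x.
by apply/quasigroup_eq/empty_algebra_eq => x; [apply: Q0|apply: R0].
Qed.

Lemma Gamma_inj : injective (fobj Gamma).
Proof.
by move=> Q R /(congr1 (fun X : ssquasigroup => base X)) /Gamma_base_inj.
Qed.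

Lemma Gamma_faithful : faithful Gamma.
Proof.
move=> Q R f g /(congr1 (fun h : homomorphism _ _ => hom_fun h)) e.
have e12 x1 x2 : htp1 f x1 = htp1 g x1 /\ htp2 f x2 = htp2 g x2.
  have := congr1 (fun h => h (gpair x1 x2)) e.
  by rewrite /= /gmap gfst_pair gsnd_pair => /gpair_inj.
(* For the first two components, [z] itself fills the other coordinate of the pair, so an empty [Q]
   causes no exception. *)
apply: homotopy_eq; apply: funext => z; try by have [] := e12 z z.
have [_ _ _ <-] := quasigroupP z z.
by rewrite -!htpP; have [-> ->] := e12 z (ldiv z z).
Qed.

Theorem mainTheorem2 :
  exists Gamma : functor Qtp Pcat,
    [/\ forall Q : quasigroup,
          let GQ : ssquasigroup := Gamma Q in
          GQ = Gamma_base Q :> vset /\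
          forall (x1 x2 y1 y2 : elt Q) (u v : elt GQ),
            u = triple Q x1 x2 :> vset ->
            v = triple Q y1 y2 :> vset ->
            u · v = triple Q (dual_rdiv x2 (x1 · y2))
                             (dual_ldiv (x1 · y2) y1) :> vset,
        forall (Q R : quasigroup) (f : homotopy Q R),
          let GQ : ssquasigroup := Gamma Q in
          let GR : ssquasigroup := Gamma R in
          let Gf : homomorphism GQ GR := farr Gamma f in
          forall (x1 x2 : elt Q) (u : elt GQ),
            u = triple Q x1 x2 :> vset ->
            Gf u = triple R (htp1 f x1) (htp2 f x2) :> vset,
        injective (fobj Gamma)
      & exists S : subcategory Pcat,
          [/\ forall X : Pcat, sub_obj S X <-> exists Q : Qtp, Gamma Q = X,
              forall (X Y : Pcat) (g : arr X Y),
                sub_arr S g <-> image_arr Gamma g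
            & exists F : functor Qtp (subcat S),
                functor_comp (subcat_incl S) F = Gamma /\ is_isomorphism F]].
Proof.
exists Gamma; split.
- move=> Q /=; split=> // x1 x2 y1 y2 u v eu ev.
  have -> : u = gpair x1 x2 by apply: eltval_inj.
  have -> : v = gpair y1 y2 by apply: eltval_inj.
  by rewrite /gmul !gfst_pair !gsnd_pair.
- move=> Q R f /= x1 x2 u eu.
  have -> : u = gpair x1 x2 by apply: eltval_inj.
  by rewrite /gmap gfst_pair gsnd_pair.
- exact: Gamma_inj.
(* Its objects and arrows are those of the image by definition; the corestriction is the required
   isomorphism. *)
- exists (image_subcategory Gamma_inj); split=> //.
  exists (corestr Gamma_inj); split; first exact: incl_corestr.
  exact: corestr_isomorphism Gamma_faithful.
Qed.
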